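(* Let $r=r(t)$ and $s=s(t)$ be positive integers (which may tend to infinity as $t\to\infty$) such that $r=\omega(st)$. Let $G^{(j)}=K_2$ for $1\le j<t$, let $G^{(t)}=S(r,s)$, and let $G=G^{(1)}\square\cdots\square G^{(t)}$. Let $p\le \frac{1}{4st}$. Then, with probability tending to $1$ as $t\to\infty$, every connected component of the random subgraph $G_p$ has at most $\frac{2|V(G)|}{s}$ vertices.
   Context: For graphs $G^{(1)},\dots,G^{(t)}$, the Cartesian product $G=G^{(1)}\square\cdots\square G^{(t)}$ has vertex set $\{(v_1,\dots,v_t): v_i\in V(G^{(i)})\}$, with $uv$ an edge iff there is an $i$ such that $u_iv_i\in E(G^{(i)})$ and $u_j=v_j$ for all $j\ne i$. $S(r,s)$ denotes the graph obtained from the complete graph $K_r$ by attaching $s$ new leaves to each vertex of $K_r$. For a graph $G$ and $p\in[0,1]$, $G_p$ is the random subgraph of $G$ on the same vertex set obtained by retaining each edge independently with probability $p$. All asymptotics are as $t\to\infty$. *)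

(* Defs.v *)
From HB Require Import structures.
From mathcomp Require Import all_boot all_order all_algebra.
From mathcomp Require Import reals.

Set Implicit Arguments.
Unset Strict Implicit.
Unset Printing Implicit Defensive.

Import Order.TTheory GRing.Theory Num.Theory.

Record sgraph := SGraph {
  vertex :> finType;
  adj : rel vertex;
  adj_sym : symmetric adj;
  adj_irr : irreflexive adj }.

Definition edges (G : sgraph) : {set {set G}} :=
  [set [set xy.1; xy.2] | xy : G * G & adj xy.1 xy.2].

Definition components (G : sgraph) : {set {set G}} :=
  equivalence_partition (connect (@adj G)) [set: G].

Section Complete.
Variable n : nat.

Definition complete_adj : rel 'I_n := fun x y => x != y.

Lemma complete_sym : symmetric complete_adj.
Proof. by move=> x y; rewrite /complete_adj eq_sym. Qed.

Lemma complete_irr : irreflexive complete_adj.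
Proof. by move=> x; rewrite /complete_adj eqxx. Qed.

Definition complete_graph := SGraph complete_sym complete_irr.
End Complete.

(* S(r, s): [inl i] is the i-th vertex of K_r, and [inr (i, k)] is the k-th
   leaf attached to it. *)
Section CompleteLeaves.
Variables r s : nat.

Definition complete_leaves_adj : rel ('I_r + 'I_r * 'I_s)%type := fun x y =>
  match x, y with
  | inl i, inl j => i != j
  | inl i, inr (j, _) => i == j
  | inr (i, _), inl j => i == j
  | inr _, inr _ => false
  end.

Lemma complete_leaves_sym : symmetric complete_leaves_adj.
Proof. by move=> [i|[i k]] [j|[j l]] //=; rewrite eq_sym. Qed.

Lemma complete_leaves_irr : irreflexive complete_leaves_adj.
Proof. by move=> [i|[i k]] //=; rewrite eqxx. Qed.

Definition complete_leaves := SGraph complete_leaves_sym complete_leaves_irr.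
End CompleteLeaves.

Section CartesianProduct.
Variables (t : nat) (G : 'I_t -> sgraph).

Definition cart_adj : rel {dffun forall i : 'I_t, G i} := fun u v =>
  [exists i, adj (u i) (v i) && [forall j, (j != i) ==> (u j == v j)]].

Lemma cart_sym : symmetric cart_adj.
Proof.
move=> u v; rewrite /cart_adj; apply: eq_existsb => i /=.
rewrite [LHS]/= adj_sym; congr andb.
by apply: eq_forallb => j; rewrite (eq_sym (u j)).
Qed.

Lemma cart_irr : irreflexive cart_adj.
Proof. by move=> u; apply/negbTE/existsP => -[i]; rewrite adj_irr. Qed.

Definition cart_prod := SGraph cart_sym cart_irr.
End CartesianProduct.

Section RandomSubgraph.
Variable G : sgraph.

Section Spanning.
Variable F : {set {set G}}.

Definition spanning_adj : rel G := fun x y =>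
  (x != y) && ([set x; y] \in F).

Lemma spanning_sym : symmetric spanning_adj.
Proof. by move=> x y; rewrite /spanning_adj eq_sym setUC. Qed.

Lemma spanning_irr : irreflexive spanning_adj.
Proof. by move=> x; rewrite /spanning_adj eqxx. Qed.

Definition spanning_subgraph := SGraph spanning_sym spanning_irr.
End Spanning.

Local Open Scope ring_scope.

Variables (R : realType) (p : R).

(* The probability that G_p has edge set exactly F. *)
Definition Gp_weight (F : {set {set G}}) : R :=
  p ^+ #|F| * (1 - p) ^+ #|edges G :\: F|.

(* The probability that G_p satisfies Q. *)
Definition Gp_prob (Q : pred sgraph) : R :=
  \sum_(F in powerset (edges G) | Q (spanning_subgraph F)) Gp_weight F.

End RandomSubgraph.

Lemma edges_spanning_subgraph (G : sgraph) (F : {set {set G}}) :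
  F \subset edges G -> edges (spanning_subgraph F) = F.
Proof.
move=> /subsetP FE; apply/setP => e; apply/imsetP/idP.
  by move=> [xy]; rewrite inE => /andP[_ xyF] ->.
move=> eF; have /imsetP[xy] := FE _ eF; rewrite inE => xyG def_e.
exists xy => //; rewrite inE /= /spanning_adj -def_e eF andbT.
by apply: contraTneq xyG => ->; rewrite adj_irr.
Qed.

Lemma Gp_probT (G : sgraph) (R : realType) (p : R) :
  Gp_prob G p predT = 1%R.
Proof.
pose E := edges G.
pose f e : R := (if e \in E then p else 0)%R.
pose g e : R := (if e \in E then 1 - p else 1)%R.
have fg e : (f e + g e = 1)%R.
  by rewrite /f /g; case: ifP => _; rewrite ?add0r // addrC subrK.
transitivity (\prod_(e : {set G}) (f e + g e))%R; last first.
  by rewrite big1.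
rewrite bigA_distr /Gp_prob big_mkcond; apply: eq_bigr => F _.
rewrite andbT powersetE -/E (bigID (mem F)) /=.
have [FE|/subsetPn[e eF eE]] := boolP (F \subset E); last first.
  by rewrite (bigD1 e) //= eF /f (negbTE eE) !mul0r.
rewrite /Gp_weight -/E -!prodr_const; congr (_ * _)%R.
  by apply: eq_bigr => e eF; rewrite eF /f (subsetP FE).
rewrite big_mkcond [RHS]big_mkcond; apply: eq_bigr => e _.
by rewrite inE /g; case: (e \in F) => //=.
Qed.

(* The index i : 'I_t stands for the 1-based index i.+1, so i.+1 = t is the
   last factor. *)
Definition factor (r s t : nat) (i : 'I_t) : sgraph :=
  if i.+1 == t then complete_leaves r s else complete_graph 2.

Definition product_graph (r s t : nat) : sgraph :=
  cart_prod (@factor r s t).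

(* Main.v *)
Require Import Defs.
From HB Require Import structures.
From mathcomp Require Import all_boot all_order all_algebra.
From mathcomp Require Import all_classical all_reals all_analysis.
From mathcomp Require Import zify ring lra.

(* Let K be the set of vertices whose last coordinate lies in K_r, so that
   |V(G)| = (s + 1)|K|. A vertex outside K has at most t neighbours outside K
   and exactly one in K. By the union bound over simple paths that meet K only
   in their last vertex, a given vertex outside K is joined to K in G_p with
   probability at most sum_l t^l p^(l+1) = p / (1 - tp) <= 1 / (3st), so by
   Markov's inequality at most |V(G)|/s such vertices are joined to K, except
   with probability at most 1/(3t). A component meeting K then has at most
   |K| + |V(G)|/s vertices, while one avoiding K has constant last coordinate,
   hence at most |V(G)|/(r(s + 1)) <= |K| vertices. *)

Set Implicit Arguments.
Unset Strict Implicit.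
Unset Printing Implicit Defensive.

Import Order.TTheory GRing.Theory Num.Theory.
Import numFieldNormedType.Exports.

(** * The distribution of the random edge set *)

Section Weight.
Variables (G : sgraph) (R : realType) (p : R).
Local Open Scope ring_scope.

Lemma Gp_weight_ge0 (F : {set {set G}}) : 0 <= p <= 1 -> 0 <= Gp_weight p F.
Proof.
by case/andP=> p0 p1; rewrite mulr_ge0 // exprn_ge0 // subr_ge0.
Qed.

(** Expand the product of the sums [f e + g e] over all sets [e]: as [f] vanishes off [E] and [g]
    vanishes on [A], only the terms with [A] inside [F] and [F] inside [E] survive. Each factor is
    [p] on [A] and 1 elsewhere. *)
Lemma Gp_prob_superset (A : {set {set G}}) : A \subset edges G ->
  \sum_(F in powerset (edges G) | A \subset F) Gp_weight p F = p ^+ #|A|.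
Proof.
set E := edges G => AE.
pose f e : R := if e \in E then p else 0.
pose g e : R := if e \in A then 0 else if e \in E then 1 - p else 1.
transitivity (\prod_(e : {set G}) (f e + g e)); last first.
  rewrite -prodr_const [RHS]big_mkcond; apply: eq_bigr => e _.
  rewrite /f /g; case: (boolP (e \in A)) => [eA|_].
    by rewrite (fintype.subsetP AE) ?addr0.
  by case: ifP => _; rewrite ?add0r // addrC subrK.
rewrite bigA_distr big_mkcond; apply: eq_bigr => F _.
rewrite powersetE (bigID (mem F)) /=.
have [FE|/subsetPn[e eF eE]] := boolP (F \subset E); last first.
  by rewrite (bigD1 e) //= eF /f (negbTE eE) !mul0r.
have [AF|/subsetPn[e eA eF]] := boolP (A \subset F); last first.
  by rewrite mulrC (bigD1 e) //= (negbTE eF) /g eA !mul0r.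
rewrite /Gp_weight -/E -!prodr_const; congr (_ * _).
  by apply: eq_bigr => e eF; rewrite eF /f (fintype.subsetP FE).
rewrite big_mkcond [RHS]big_mkcond; apply: eq_bigr => e _.
rewrite inE /g; case: (boolP (e \in F)) => //= eF.
by rewrite (contraNF (fintype.subsetP AF e) eF).
Qed.

Lemma Gp_prob_predC (Q : pred sgraph) :
  Gp_prob G p Q = 1 - Gp_prob G p (predC Q).
Proof.
apply/eqP; rewrite eq_sym subr_eq -(Gp_probT G p) /Gp_prob; apply/eqP.
rewrite (bigID (fun F => Q (spanning_subgraph F))) /=.
by congr (_ + _); apply: eq_bigl => F; rewrite andbT.
Qed.

Lemma Gp_prob_markov (Q : pred sgraph) (X : {set {set G}} -> R) :
  0 <= p <= 1 -> (forall F, 0 <= X F) ->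
  (forall F, Q (spanning_subgraph F) -> 1 <= X F) ->
  Gp_prob G p Q <= \sum_(F in powerset (edges G)) Gp_weight p F * X F.
Proof.
move=> p01 X0 X1; rewrite /Gp_prob big_mkcondr; apply: ler_sum => F _.
case: ifP => [/X1 ?|_]; last by rewrite mulr_ge0 ?Gp_weight_ge0.
by rewrite ler_peMr ?Gp_weight_ge0.
Qed.

End Weight.

(** * Edge sets of paths *)

Section PathEdges.
Variable G : sgraph.

Definition path_edges (x : G) (q : seq G) : {set {set G}} :=
  [set:: pairmap (fun a b => [set a; b]%SET) x q].

Lemma path_edges_cons x y q :
  path_edges x (y :: q) = ([set x; y] |: path_edges y q)%SET.
Proof. by apply/setP => e; rewrite !inE. Qed.

Lemma path_edges_mem x q e z : e \in path_edges x q -> z \in e -> z \in x :: q.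
Proof.
elim: q x => [|y q IH] x; first by rewrite inE.
rewrite path_edges_cons 2!inE => /orP[/eqP->|eq ze].
  by rewrite !inE => /orP[]->; rewrite ?orbT.
by rewrite in_cons (IH y) ?orbT.
Qed.

(** On a simple path the first edge contains [x], which no later edge does, so each step adds a new
    edge. *)
Lemma card_path_edges x q : uniq (x :: q) -> #|path_edges x q| = size q.
Proof.
elim: q x => [|y q IH] x.
  by move=> _; apply/eqP; rewrite cards_eq0; apply/eqP/setP => e; rewrite !inE.
rewrite cons_uniq path_edges_cons => /andP[xyq /IH {}IH].
rewrite cardsU1 IH (contraNN (fun e => path_edges_mem e _) xyq) //.
by rewrite !inE eqxx.
Qed.

Lemma path_edges_sub x q : path (@adj G) x q -> path_edges x q \subset edges G.
Proof.
elim: q x => [|y q IH] x /=; first by move=> _; apply/fintype.subsetP => e; rewrite inE.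
case/andP=> xy /IH yq; rewrite path_edges_cons finset.subUset yq andbT finset.sub1set.
by apply/imsetP; exists (x, y); rewrite ?inE.
Qed.

Lemma path_edges_subset (F : {set {set G}}) x q :
  path (spanning_adj F) x q -> path_edges x q \subset F.
Proof.
elim: q x => [|y q IH] x /=; first by move=> _; apply/fintype.subsetP => e; rewrite inE.
case/andP=> /andP[_ xy] /IH yq; rewrite path_edges_cons finset.subUset yq andbT.
by rewrite finset.sub1set.
Qed.

Lemma spanning_adj_sub (F : {set {set G}}) x y :
  F \subset edges G -> spanning_adj F x y -> adj x y.
Proof.
move=> /fintype.subsetP FE /andP[xy /FE/imsetP[[a b]]]; rewrite inE /= => ab exy.
have: a \in [set x; y]%SET by rewrite exy !inE eqxx.
have: b \in [set x; y]%SET by rewrite exy !inE eqxx orbT.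
have nab : a != b by apply: contraTneq ab => ->; rewrite adj_irr.
rewrite !inE => /orP[]/eqP eb /orP[]/eqP ea; move: ab nab; rewrite ea eb ?eqxx //.
by rewrite adj_sym.
Qed.

End PathEdges.

(** * Walks that stop on reaching [K], and the union bound over them *)

Section Hitting.
Variables (G : sgraph) (K : {set G}).

(* Walks from [x] of length [l.+1] whose last vertex is the only one, except
   possibly [x], that lies in [K]. *)
Fixpoint hitting_walks (l : nat) (x : G) : seq (seq G) :=
  if l is l'.+1 then
    [seq y :: q | y <- enum [set y | adj x y & y \notin K]%SET,
                  q <- hitting_walks l' y]
  else [seq [:: y] | y <- enum [set y in K | adj x y]%SET].

(** Each of the first [l] steps stays outside [K] and has at most [d] choices; the final step into
    [K] has at most one. *)
Lemma size_hitting_walks (d l : nat) (x : G) :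
  (forall x, x \notin K -> #|[set y in K | adj x y]%SET| <= 1) ->
  (forall x, x \notin K -> #|[set y | adj x y & y \notin K]%SET| <= d) ->
  x \notin K -> size (hitting_walks l x) <= d ^ l.
Proof.
move=> K1 Kd; elim: l x => [|l IH] x xK /=; first by rewrite size_map -cardE K1.
rewrite size_allpairs_dep expnS sumnE big_map big_enum /=.
apply: (@leq_trans (\sum_(y in [set y | adj x y & y \notin K]%SET) d ^ l)).
  by apply: leq_sum => y; rewrite inE => /andP[_ /IH].
by rewrite sum_nat_const leq_mul2r Kd ?orbT.
Qed.

Lemma hitting_walksP (l : nat) (x : G) (q : seq G) :
  q \in hitting_walks l x -> size q = l.+1 /\ path (@adj G) x q.
Proof.
elim: l x q => [|l IH] x q /=.
  by case/mapP => y; rewrite mem_enum inE => /andP[_ xy] -> /=; rewrite xy.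
case/allpairsPdep => y [q'] []; rewrite mem_enum inE => /andP[xy _] /IH[sq yq] ->.
by rewrite /= sq xy yq.
Qed.

(** A simple path from [x] to [z] is cut at its first vertex in [K]. *)
Lemma connect_hitting_walk (F : {set {set G}}) (x z : G) :
  F \subset edges G -> x \notin K -> z \in K -> connect (spanning_adj F) x z ->
  exists l q, [/\ (l < #|G|)%N, q \in hitting_walks l x, uniq (x :: q) &
    path_edges x q \subset F].
Proof.
move=> FE xK zK /connectP[q0 /shortenP[q xq uq _ zq]].
(* The induction only has to track [subseq], from which simplicity of the truncated path follows. *)
suff [l [q' [sq hq xq']]] : exists l q', [/\ subseq q' q,
    q' \in hitting_walks l x & path (spanning_adj F) x q'].
  have uq' : uniq (x :: q').
    by apply: subseq_uniq uq; rewrite /= eqxx.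
  exists l, q'; split=> //; last exact: path_edges_subset.
  have [<- _] := hitting_walksP hq.
  (* The walk together with [x] has [l + 2] distinct vertices. *)
  by have := max_card (mem (x :: q')); rewrite (card_uniqP uq') /=; lia.
move: zK; rewrite {}zq; elim: q x xq xK {uq q0} => [|y q IH] x /=.
  by move=> _ /negbTE ->.
case/andP=> xy yq xK lK; have axy := spanning_adj_sub FE xy.
have [yK|yK] := boolP (y \in K).
  exists 0, [:: y]; split=> /=; rewrite ?eqxx ?sub0seq ?xy //.
  by apply/mapP; exists y; rewrite // mem_enum inE yK.
have [l [q' [sq hq xq']]] := IH y yq yK lK.
exists l.+1, (y :: q'); split=> /=; rewrite ?eqxx ?xy //.
by apply/allpairsPdep; exists y, q'; split; rewrite // mem_enum inE axy.
Qed.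

Definition attached (F : {set {set G}}) : {set G} :=
  [set x | x \notin K & [exists z in K, connect (spanning_adj F) x z]]%SET.

Local Open Scope ring_scope.

(** Linearity of expectation over [x], then the union bound over simple hitting walks: one of length
    [l.+1] has that many distinct edges, hence lies in [F] with probability [p ^+ l.+1], and there
    are at most [d ^ l] of them. *)
Lemma expected_attached (R : realType) (p : R) (d : nat) :
  0 <= p <= 1 ->
  (forall x, x \notin K -> #|[set y in K | adj x y]%SET| <= 1)%N ->
  (forall x, x \notin K -> #|[set y | adj x y & y \notin K]%SET| <= d)%N ->
  \sum_(F in powerset (edges G)) Gp_weight p F * #|attached F|%:R <=
  #|G|%:R * \sum_(l < #|G|) d%:R ^+ l * p ^+ l.+1.
Proof.
move=> p01 K1 Kd; have p0 : 0 <= p by case/andP: p01.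
pose hit (x : G) (l : nat) (F : {set {set G}}) : R :=
  \sum_(q <- hitting_walks l x | uniq (x :: q)) (path_edges x q \subset F)%:R : R.
have hit0 x l F : 0 <= hit x l F by apply: sumr_ge0.
have attached_le F : F \in powerset (edges G) ->
    #|attached F|%:R <= \sum_(x | x \notin K) \sum_(l < #|G|) hit x l F.
  rewrite powersetE => FE.
  rewrite -sum1_card natr_sum big_mkcond [leRHS]big_mkcond.
  apply: ler_sum => x _; rewrite inE; case: ifP => /=; last first.
    by move=> _; case: ifP => // _; apply: sumr_ge0.
  case/andP=> xK /existsP[z /andP[zK xz]]; rewrite xK.
  have [l [q [lG hq uq qF]]] := connect_hitting_walk FE xK zK xz.
  rewrite (bigD1 (Ordinal lG)) //= -[leLHS]addr0 lerD ?sumr_ge0 //.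
  rewrite /hit big_mkcond (big_rem _ hq) /= -/(uniq (x :: q)) uq qF.
  by rewrite lerDl sumr_ge0 // => q' _; case: ifP.
apply: (@le_trans _ _ (\sum_(F in powerset (edges G))
   Gp_weight p F * \sum_(x | x \notin K) \sum_(l < #|G|) hit x l F)).
  by apply: ler_sum => F FE; rewrite ler_wpM2l ?Gp_weight_ge0 ?attached_le.
under eq_bigr do rewrite mulr_sumr.
rewrite exchange_big /=.
apply: (@le_trans _ _ (\sum_(x : G | x \notin K)
   \sum_(l < #|G|) d%:R ^+ l * p ^+ l.+1)); last first.
  rewrite sumr_const -[leLHS]mulr_natl ler_wpM2r ?ler_nat ?max_card //.
  by apply: sumr_ge0 => l _; rewrite mulr_ge0 ?exprn_ge0.
apply: ler_sum => x xK.
under eq_bigr do rewrite mulr_sumr.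
rewrite exchange_big /=; apply: ler_sum => l _.
under eq_bigr do rewrite mulr_sumr.
rewrite exchange_big /=.
apply: (@le_trans _ _ (\sum_(q <- hitting_walks l x) p ^+ l.+1)); last first.
  rewrite big_const_seq count_predT iter_addr_0.
  rewrite -[leLHS]mulr_natl ler_wpM2r ?exprn_ge0 //.
  by rewrite -natrX ler_nat size_hitting_walks.
(* Walks that are not simple contribute 0 on the left, so counting all walks on the right is
   harmless. *)
rewrite big_mkcond big_seq [leRHS]big_seq; apply: ler_sum => q /hitting_walksP[sq xq].
case: ifP => [uq|_]; last by rewrite exprn_ge0.
rewrite -sq -(card_path_edges uq) -Gp_prob_superset ?path_edges_sub //.
rewrite [leRHS]big_mkcondr; apply: ler_sum => F _.
by case: ifP; rewrite ?mulr1 ?mulr0.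
Qed.

(** A component meeting [K] lies in the union of [K] and [attached F]. On one avoiding [K], [f] is
    constant along every path, so it lies in a single level set of [f]. *)
Lemma card_component_le (F : {set {set G}}) (C : {set G}) (m : nat)
    (T : eqType) (f : G -> T) :
  F \subset edges G ->
  (forall x y, x \notin K -> y \notin K -> adj x y -> f x = f y) ->
  (forall x, x \notin K -> #|[set y | f y == f x]%SET| <= m)%N ->
  C \in components (spanning_subgraph F) ->
  (#|C| <= maxn m (#|K| + #|attached F|))%N.
Proof.
move=> FE fadj fm; rewrite leq_max.
have eqC : {in [set: spanning_subgraph F]%SET & &,
    equivalence_rel (connect (@adj (spanning_subgraph F)))}.
  move=> x y z _ _ _; split=> [|xy]; first exact: connect0.
  exact/(same_connect (sym_connect_sym (@adj_sym _))).
move=> CP; have {CP} [x ->] : exists x : G,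
    C = [set y | connect (spanning_adj F) x y]%SET.
  by case/imsetP: CP => x _ ->; exists x; apply/setP => y; rewrite !inE.
have [/existsP[z /andP[zK xz]]|noK] :=
    boolP [exists z in K, connect (spanning_adj F) x z].
  apply/orP; right; apply: leq_trans (leq_card_setU _ _).
  apply/subset_leq_card/fintype.subsetP => y; rewrite !inE => xy.
  case: (boolP (y \in K)) => //= yK; apply/existsP; exists z; rewrite zK /=.
  by apply: connect_trans xz; rewrite (sym_connect_sym (@spanning_sym _ F)).
have notK y : connect (spanning_adj F) x y -> y \notin K.
  by move=> xy; apply: contraNN noK => yK; apply/existsP; exists y; rewrite yK.
apply/orP; left; apply: leq_trans (fm x _); last exact: notK.
apply/subset_leq_card/fintype.subsetP => y; rewrite !inE => /connectP[q xq ->].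
elim/last_ind: q xq => [|q z IH] //.
rewrite rcons_path last_rcons => /andP[xq qz].
rewrite -(eqP (IH xq)); apply/eqP/esym/fadj.
- by apply: notK; apply/connectP; exists q.
- apply: notK; apply/connectP; exists (rcons q z); rewrite ?last_rcons //.
  by rewrite rcons_path xq.
- exact: spanning_adj_sub qz.
Qed.

End Hitting.

(** * Fibres of a coordinate of a Cartesian product *)

Section ProductFibres.
Variables (t : nat) (H : 'I_t -> sgraph) (m : 'I_t).
Local Notation G := (cart_prod H).

Definition fibre (a : H m) : {set G} := [set u : G | u m == a]%SET.

(** Overwriting coordinate [m] by [b] is injective on the fibre of [a]. *)
Lemma card_fibre_le (a b : H m) : #|fibre a| <= #|fibre b|.
Proof.
pose f (u : G) : G := finfun (@eqtype.dfwith 'I_t (fun j => H j) (fun j => u j) m b).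
have fm u : f u m = b by rewrite ffunE dfwith_in.
have fN u j : j != m -> f u j = u j by move=> jm; rewrite ffunE dfwith_out // eq_sym.
rewrite -(@card_in_imset _ _ f); last first.
  move=> u v; rewrite !inE => /eqP um /eqP vm fuv; apply/ffunP => j.
  have [->|jm] := eqVneq j m; first by rewrite um vm.
  by rewrite -(fN u) // fuv fN.
apply/subset_leq_card/fintype.subsetP => v /imsetP[u _ ->].
by rewrite inE fm.
Qed.

Lemma card_fibre_eq (a b : H m) : #|fibre a| = #|fibre b|.
Proof. by apply/eqP; rewrite eqn_leq !card_fibre_le. Qed.

Lemma card_preim_coordinate (A : {set H m}) (a : H m) :
  #|[set u : G | u m \in A]%SET| = #|A| * #|fibre a|.
Proof.
rewrite -sum1_card (partition_big (fun u : G => u m) (mem A)) /=; last first.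
  by move=> u; rewrite inE.
rewrite -sum_nat_const; apply: eq_bigr => b bA.
rewrite -(card_fibre_eq b) -sum1_card; apply: eq_bigl => u.
by rewrite !inE andb_idl // => /eqP->.
Qed.

Lemma card_cart_prod (a : H m) : #|G| = #|H m| * #|fibre a|.
Proof.
rewrite -[#|H m|]cardsT -card_preim_coordinate -cardsT.
by apply: eq_card => u; rewrite !inE.
Qed.

End ProductFibres.


(** * Neighbours of vertices outside a cylinder *)

Section ProductDegrees.
Variables (t : nat) (H : 'I_t -> sgraph) (m : 'I_t) (A : {set H m}).
Local Notation G := (cart_prod H).

Hypothesis deg1_other : forall j, j != m -> forall x y z : H j,
  adj x y -> adj x z -> y = z.
Hypothesis deg1_notin : forall x y z : H m, x \notin A ->
  adj x y -> adj x z -> y = z.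
Hypothesis adj_notin : forall x y : H m, x \notin A -> adj x y -> y \in A.

(** With [A] the clique of S(r, s), this is the set [K]; the hypotheses say that vertices off [A]
    behave as leaves and the other factors as K_2. *)
Definition cylinder : {set G} := [set u : G | u m \in A]%SET.

Lemma cart_adjP (u v : G) : adj u v ->
  exists i, adj (u i) (v i) /\ forall j, j != i -> u j = v j.
Proof.
case/existsP => i /andP[uv /forallP e]; exists i; split=> // j ji.
by have /implyP/(_ ji)/eqP := e j.
Qed.

Lemma cylinderN_adj (u v : G) : u \notin cylinder -> v \notin cylinder ->
  adj u v -> u m = v m.
Proof.
rewrite !inE => uA vA /cart_adjP[i [uv e]]; have [im|im] := eqVneq i m.
  by subst i; rewrite (adj_notin uA uv) in vA.
by apply: e; rewrite eq_sym.
Qed.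

(** An edge changes exactly one coordinate, and in each factor the relevant coordinate of [u] has at
    most one neighbour, so the direction determines the neighbour. *)
Lemma cart_neighbour_inj (u v w : G) (i : 'I_t) : u \notin cylinder ->
  adj u v -> adj u w -> u i != v i -> u i != w i -> v = w.
Proof.
rewrite inE => uA /cart_adjP[j [uvj ev]] /cart_adjP[k [uwk ew]] uvi uwi.
have ij : i = j by apply/eqP; apply: contraNT uvi => /ev ->.
have ik : i = k by apply/eqP; apply: contraNT uwi => /ew ->.
subst j k; apply/ffunP => l; have [li|li] := eqVneq l i; last by rewrite -ev ?ew.
subst l; have [im|im] := eqVneq i m; last exact: deg1_other uvj uwk.
by subst i; apply: deg1_notin uvj uwk.
Qed.

Lemma cylinderN_neighbours_in (u : G) : u \notin cylinder ->
  #|[set v in cylinder | adj u v]%SET| <= 1.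
Proof.
move=> uA; apply/card_le1_eqP => v w.
rewrite !inE => /andP[vA uv] /andP[wA uw].
have neq (x : G) : x m \in A -> u m != x m.
  by move=> xA; apply: contraNneq uA => e; rewrite inE e.
exact: (cart_neighbour_inj uA uw uv (neq w wA) (neq v vA)).
Qed.

Lemma cylinderN_neighbours_notin (u : G) : u \notin cylinder ->
  #|[set v | adj u v & v \notin cylinder]%SET| <= t.
Proof.
(* The default [m] is never reached when [v] is a neighbour of [u]. *)
move=> uA; pose dir (v : G) := odflt m [pick i | u i != v i].
have dirP v : adj u v -> u (dir v) != v (dir v).
  move=> uv; rewrite /dir; case: pickP => //= uv_eq; have [i [uvi _]] := cart_adjP uv.
  by move/negbFE/eqP: (uv_eq i) uvi => ->; rewrite adj_irr.
rewrite -[leqRHS]card_ord -(@card_in_imset _ _ dir) ?max_card // => v w.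
rewrite !inE => /andP[uv _] /andP[uw _] dir_eq.
by apply: (cart_neighbour_inj uA uv uw (dirP v uv)); rewrite dir_eq dirP.
Qed.

End ProductDegrees.

(** * The factors K_2 and S(r, s), and the set [K] in their product *)

(** The equation on [H] is a hypothesis because each factor equals its intended graph only
    propositionally; rewriting with it makes the vertices concrete. *)
Lemma complete_graph2_deg1 (H : sgraph) : H = complete_graph 2 ->
  forall x y z : H, adj x y -> adj x z -> y = z.
Proof.
move=> -> x y z xy xz; apply/eqP; move: x y z xy xz.
by do 3!case=> [[|[]]] //= ?.
Qed.

Lemma complete_leaves_core (r s : nat) (H : sgraph) :
  H = complete_leaves r s ->
  exists A : {set H}, [/\ #|A| = r, #|H| = r * s.+1,
    forall x y z, x \notin A -> adj x y -> adj x z -> y = z &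
    forall x y, x \notin A -> adj x y -> y \in A].
Proof.
move=> ->; exists (inl @: [set: 'I_r]%SET : {set complete_leaves r s}); split.
- by rewrite card_imset ?cardsT ?card_ord // => i j [].
- by rewrite card_sum card_prod !card_ord mulnS.
- move=> [i|[i k]] y z; first by rewrite imset_f.
  by case: y z => [j|[]] // [j'|[]] // _ /eqP <- /eqP <-.
- move=> [i|[i k]] y; first by rewrite imset_f.
  by case: y => [j|[]] // _ _; rewrite imset_f.
Qed.

(* [K] is the set of vertices over K_r, and [f] is the last coordinate, whose
   type is only propositionally equal to the vertex type of S(r, s). *)
Lemma product_graph_core (r s t : nat) :
  exists K : {set product_graph r s t.+1}, exists T : finType,
  exists f : product_graph r s t.+1 -> T,
  [/\ #|product_graph r s t.+1| = (#|K| * s.+1)%N,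
      forall x, x \notin K -> (#|[set y in K | adj x y]%SET| <= 1)%N,
      forall x, x \notin K -> (#|[set y | adj x y & y \notin K]%SET| <= t.+1)%N,
      forall x y, x \notin K -> y \notin K -> adj x y -> f x = f y &
      (0 < r)%N -> forall x, x \notin K -> (#|[set y | f y == f x]%SET| <= #|K|)%N].
Proof.
set m : 'I_t.+1 := ord_max.
have Hm : Defs.factor r s m = complete_leaves r s by rewrite /Defs.factor eqxx.
have HN (j : 'I_t.+1) : j != m -> Defs.factor r s j = complete_graph 2.
  by rewrite -val_eqE /Defs.factor eqSS /= => /negbTE ->.
have [A [cA cH dA adjA]] := complete_leaves_core Hm.
have dN j (jm : j != m) := complete_graph2_deg1 (HN j jm).
exists (cylinder A), (Defs.factor r s m : finType),
  (fun u : {dffun forall i : 'I_t.+1, Defs.factor r s i} => u m); split.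
- have [x _|H0] := pickP (mem (Defs.factor r s m)).
    by rewrite (card_cart_prod x) (card_preim_coordinate _ x) cH cA mulnAC.
  (* With an empty last factor no fibre is available to count with, but both sides are 0. *)
  have e : #|product_graph r s t.+1| = 0.
    by apply: eq_card0 => u; have := H0 (u m); rewrite inE.
  have e' := leq_trans (max_card (mem (cylinder A))) (eq_leq e).
  by rewrite e; move: e'; rewrite leqn0 => /eqP ->.
- exact: cylinderN_neighbours_in.
- exact: cylinderN_neighbours_notin.
- exact: cylinderN_adj.
- by move=> r0 x _; rewrite (card_preim_coordinate _ (x m)) cA leq_pmull.
Qed.

(** * The quantitative probability bound *)

(** If S is the sum of the powers of [d * p], then S(1 - dp) = 1 - (dp)^n <= 1, while 1 - dp >=
    3/4. *)
Lemma geometric_sum_le (R : realFieldType) (p d : R) (n : nat) :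
  (0 <= p -> 0 <= d -> d * p <= 4^-1 ->
  \sum_(l < n) d ^+ l * p ^+ l.+1 <= p * (4 / 3))%R.
Proof.
move=> p0 d0 dp; have dp0 := mulr_ge0 d0 p0.
under eq_bigr do rewrite exprS mulrCA -exprMn.
rewrite -mulr_sumr ler_wpM2l //.
have := subrX1 (d * p) n; have := exprn_ge0 n dp0.
have : (0 <= \sum_(i < n) (d * p) ^+ i)%R by apply: sumr_ge0 => i _; rewrite exprn_ge0.
move: (\sum_(i < n) _)%R ((_ ^+ n)%R) => S x S0 x0 e.
have : (d * p * S <= 4^-1 * S)%R by rewrite ler_wpM2r.
by move: e; rewrite mulrBl mul1r; lra.
Qed.

Lemma product_graph_component_prob (R : realType) (r s t : nat) (p : R) :
  (0 < r)%N -> (0 < s)%N ->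
  (0 <= p <= 1 -> p <= 1 / (4 * s%:R * t.+1%:R) ->
  1 - (3 * t.+1%:R)^-1 <= Gp_prob (product_graph r s t.+1) p
    (fun H : sgraph => [forall C in components H,
       #|C|%:R <= 2 * #|product_graph r s t.+1|%:R / s%:R :> R]))%R.
Proof.
move=> r0 s0 p01 ple; have p0 : (0 <= p)%R by case/andP: p01.
have [K [T [f [cK K1 Kd fadj fle]]]] := product_graph_core r s t.
move: (product_graph r s t.+1) K f cK K1 Kd fadj fle => G K f cK K1 Kd fadj fle.
rewrite Gp_prob_predC lerB //.
(* Scaled for Markov's inequality: for nonempty [G], [1 <= X F] means at least |V(G)|/s attached
   vertices. *)
pose X (F : {set {set G}}) : R := (#|attached K F|%:R * (s%:R / #|G|%:R))%R.
have sR : (0 < s%:R :> R)%R by rewrite ltr0n.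
have tR : (0 < t.+1%:R :> R)%R by rewrite ltr0n.
apply: (@le_trans _ _ (\sum_(F in powerset (edges G)) Gp_weight p F * X F)%R).
  have X0 F : (0 <= X F)%R by rewrite mulr_ge0 // divr_ge0.
  rewrite /Gp_prob big_mkcondr; apply: ler_sum => F; rewrite powersetE => FE.
  case: ifP => [|_]; last by rewrite mulr_ge0 ?Gp_weight_ge0.
  rewrite /= negb_forall_in => /exists_inP[C CF].
  have := card_component_le FE fadj (fle r0) CF.
  rewrite -ltNge ltr_pdivrMr // => CK; rewrite -natrM -natrM ltr_nat => C_big.
  have CG : (#|C| <= #|G|)%N by exact: max_card.
  have n_gt0 : (0 < #|G|)%N.
    rewrite lt0n; apply: contraTneq C_big => n0.
    by move: CG; rewrite n0 leqn0 => /eqP->.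
  rewrite ler_peMr ?Gp_weight_ge0 // /X mulrA ler_pdivlMr ?ltr0n //.
  rewrite mul1r -natrM ler_nat.
  (* From s|C| > 2(s + 1)|K| and |C| <= |K| + a, where a counts the attached vertices, one gets sa >
     (s + 2)|K| >= |V(G)|. *)
  move: CK C_big; rewrite (maxn_idPr (leq_addr _ _)) cK.
  move: #|C| #|attached K F| #|K| => c a k; nia.
under eq_bigr => F _ do rewrite [(_ * X F)%R]mulrA.
rewrite -mulr_suml.
apply: le_trans (_ : (#|G|%:R * (p * (4 / 3)) * (s%:R / #|G|%:R) <= _)%R).
  rewrite ler_wpM2r ?divr_ge0 //; apply: le_trans (expected_attached p01 K1 Kd) _.
  rewrite ler_wpM2l ?geometric_sum_le //.
  (* As s >= 1, the ratio [t.+1%:R * p] of the geometric sum is at most 1/4. *)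
  have : (p * (4 * s%:R * t.+1%:R) <= 1)%R by rewrite -ler_pdivlMr ?mulr_gt0.
  have : (0 <= t.+1%:R * p * (s%:R - 1))%R by rewrite !mulr_ge0 ?subr_ge0 ?ler1n.
  by move: (s%:R : R)%R (t.+1%:R : R)%R => a b; lra.
have [->|n_neq0] := eqVneq #|G| 0%N.
  by rewrite !mul0r invr_ge0 mulr_ge0.
rewrite (_ : _ * _ = p * (4 / 3) * s%:R)%R; last by field; rewrite pnatr_eq0.
apply: le_trans (_ : (1 / (4 * s%:R * t.+1%:R) * (4 / 3) * s%:R <= _)%R).
  by rewrite !ler_wpM2r // ltW.
by rewrite le_eqVlt; apply/orP; left; apply/eqP; field; rewrite !gt_eqF.
Qed.

(** * Passage to the limit *)

Local Open Scope classical_set_scope.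
Local Open Scope ring_scope.

Theorem theorem1p7 (R : realType) (r s : nat -> nat) (p : nat -> R)
  (r_gt0 : forall t : nat, (0 < t)%N -> (0 < r t)%N)
  (s_gt0 : forall t : nat, (0 < t)%N -> (0 < s t)%N)
  (r_omega : ((r t)%:R / (s t * t)%:R : R) @[t --> \oo] --> +oo)
  (p_01 : forall t : nat, (0 < t)%N -> 0 <= p t <= 1)
  (p_le : forall t : nat, (0 < t)%N -> p t <= 1 / (4 * (s t)%:R * t%:R)) :
  Gp_prob (product_graph (r t) (s t) t) (p t)
    (fun H : sgraph => [forall C in components H,
       #|C|%:R <= 2 * #|product_graph (r t) (s t) t|%:R / (s t)%:R :> R])
    @[t --> \oo] --> (1 : R).
Proof.
apply: (@squeeze_cvgr _ _ _ _ (fun t => 1 - harmonic t) (fun=> 1)); last 2 first.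
- by rewrite -[X in _ --> X]subr0; apply: cvgB; [exact: cvg_cst|exact: cvg_harmonic].
- exact: cvg_cst.
exists 1%N => // -[//|t] _ /=; apply/andP; split.
  apply: le_trans (product_graph_component_prob _ _ _ _);
    rewrite ?r_gt0 ?s_gt0 ?p_01 ?p_le //.
  (* [harmonic t.+1] is 1/(t + 2), so the comparison needed is t + 2 <= 3(t + 1). *)
  by rewrite lerB // lef_pV2 ?posrE ?mulr_gt0 ?ltr0n // -natrM ler_nat; lia.
rewrite Gp_prob_predC lerBlDr lerDl; apply: sumr_ge0 => F _.
by rewrite Gp_weight_ge0 ?p_01.
Qed.
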